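(* Let $p_1,p_2,p_3,p_4,p_5$ be a pentagon with $R(p_5)R(p_4)R(p_3)R(p_2)R(p_1)=\delta$, $\delta^3=1$. If $\delta=1$, then all $p_j$'s are negative, they span a real plane $R$ (and all lie in it), and $R$ is stable under the group generated by the reflections $R(p_1),\dots,R(p_5)$. If $\delta\ne1$, then exactly one of the $p_j$'s is positive.
   Context: $V$ is a $3$-dimensional $\mathbb C$-linear space with a hermitian form $\langle-,-\rangle$ (linear in the first argument) of signature $++-$. Elements of $V$ may denote points of $\mathbb P_{\mathbb C}V$. A point $p$ is negative, isotropic, positive if $\langle p,p\rangle<0$, $=0$, $>0$; $\mathrm SV$ denotes the set of isotropic points. For nonisotropic $p$, the reflection $R(p)\in\mathrm{SU}\,V$ is $R(p):x\mapsto 2\frac{\langle x,p\rangle}{\langle p,p\rangle}p-x$. A real plane is the image in $\mathbb P_{\mathbb C}V$ of $W\setminus\{0\}$, where $W\subset V$ is a $3$-dimensional real subspace spanning $V$ over $\mathbb C$ on which the form is real-valued. A pentagon is a configuration $p_1,\dots,p_5\in\mathbb P_{\mathbb C}V\setminus\mathrm SV$ such that at most one of the $p_j$'s is positive, $p_{j-1}$ is neither orthogonal nor equal to $p_j$ for all $j$ (indices modulo $5$), and $R(p_5)R(p_4)R(p_3)R(p_2)R(p_1)=\delta$ in $\mathrm{SU}\,V$, where $\delta^3=1$ ($\delta$ stands for the scalar operator). *)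

(* Defs.v *)
From HB Require Import structures.
From mathcomp Require Import all_boot all_order all_algebra.
From mathcomp Require Import all_classical reals.
From mathcomp Require Export complex.

Set Implicit Arguments.
Unset Strict Implicit.
Unset Printing Implicit Defensive.

Import Order.TTheory GRing.Theory Num.Theory.

Local Open Scope classical_set_scope.
Local Open Scope complex_scope.
Local Open Scope ring_scope.

(* A point of the projective space P(V) is a line of V, i.e. <[v]>%VS for some
   v != 0; a nonzero vector v : V denotes the point <[v]>%VS. *)

Section Definitions.
Variables (R : realType) (V : vectType R[i]).
Variable h : {hermitian_sym V for Num.conj}.

Definition signature_ppm : Prop :=
  exists e1 e2 e3 : V,
    [/\ basis_of fullv [:: e1; e2; e3],
        [/\ h e1 e2 = 0, h e1 e3 = 0 & h e2 e3 = 0] &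
        [/\ 0 < h e1 e1, 0 < h e2 e2 & h e3 e3 < 0]].

Definition reflection (p : V) : 'End(V) :=
  linfun (fun x => (2 * (h x p / h p p)) *: p - x).

(* linfun f agrees with f only if f is linear; this is the case above. *)
Lemma reflectionE (p x : V) :
  reflection p x = (2 * (h x p / h p p)) *: p - x.
Proof.
pose f x := (2 * (h x p / h p p)) *: p - x.
have f_lin : linear f.
  move=> a u v; rewrite /f linearDl linearZl_LR /= [_ / h p p]mulrDl.
  rewrite [2 * (_ + _)]mulrDr scalerDl -!mulrA [2 * (a * _)]mulrCA.
  by rewrite scalerBr scalerA opprD !addrA; congr (_ - _); rewrite addrAC.
pose F : {linear V -> V} :=
  HB.pack f (GRing.isLinear.Build R[i] V V *:%R f f_lin).
exact: (lfunE F).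
Qed.

(* Indices live in Z/5, so that p 5 is p 0 and j - 1 is taken modulo 5. *)
Definition pentagon (p : 'Z_5 -> V) (delta : R[i]) : Prop :=
  [/\ forall j, h (p j) (p j) != 0,
      (#|[set j : 'Z_5 | (0 < h (p j) (p j))%R]%SET| <= 1)%N,
      forall j, h (p (j - 1)) (p j) != 0 /\ <[p (j - 1)]>%VS <> <[p j]>%VS,
      (reflection (p 5) \o reflection (p 4) \o reflection (p 3) \o
         reflection (p 2) \o reflection (p 1))%VF = delta *: \1%VF &
      delta ^+ 3 = 1].

Definition real_span (I : finType) (b : I -> V) : set V :=
  [set v | exists r : I -> R, v = \sum_i (r i)%:C *: b i].

Definition real_free (I : finType) (b : I -> V) : Prop :=
  forall r : I -> R, \sum_i (r i)%:C *: b i = 0 -> forall i, r i = 0.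

Definition real_subspace_of_dim (n : nat) (W : set V) : Prop :=
  exists b : 'I_n -> V, real_free b /\ W = real_span b.

Definition complex_spanning (W : set V) : Prop :=
  exists X : seq V, (forall x, x \in X -> W x) /\ <<X>>%VS = fullv.

Definition proj_image (W : set V) : set {vspace V} :=
  [set <[w]>%VS | w in W `\ 0].

Definition real_plane (P : set {vspace V}) : Prop :=
  exists W : set V,
    [/\ real_subspace_of_dim 3 W,
        complex_spanning W,
        forall u v, W u -> W v -> h u v \is Num.real &
        P = proj_image W].

(* The points p j span P over the reals: for suitable representatives w j of
   these points, P is the image of the real span of the w j. *)
Definition real_spans (I : finType) (p : I -> V) (P : set {vspace V}) : Prop :=
  exists w : I -> V,
    (forall j, <[w j]>%VS = <[p j]>%VS) /\ P = proj_image (real_span w).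

(* The subgroup of GL(V) generated by the reflections R(p j); all its elements
   are invertible, so ^-1 is the true inverse. *)
Inductive reflection_group (I : Type) (p : I -> V) : 'End(V) -> Prop :=
| reflection_group_gen j : reflection_group p (reflection (p j))
| reflection_group_1 : reflection_group p \1%VF
| reflection_group_M f g : reflection_group p f -> reflection_group p g ->
    reflection_group p (f \o g)%VF
| reflection_group_V f : reflection_group p f -> reflection_group p (f^-1)%VF.

Definition stable_under (G : 'End(V) -> Prop) (P : set {vspace V}) : Prop :=
  forall g, G g -> [set (g @: L)%VS | L in P] = P.

End Definitions.

(* Main.v *)
Require Import Defs.
From mathcomp Require Import all_boot all_order all_algebra.
From mathcomp Require Import all_classical reals.
From mathcomp Require Import ring.

(** Write r j for the reflection in p j and g j k for h (p j) (p k). Rotating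
the relation and using that reflections are involutions gives, for all j in
Z/5,

  r (j+2) o r (j+1) o r j = delta (r (j+3) o r (j+4)).

Everything follows from this family of identities, mostly through traces. With
  tance j k = |g j k|^2 / (g j j g k k)   (a real number) and
  eta j k l = g j k g k l g l j / (g j j g k k g l l),
the trace of the right-hand side is delta (4 tance (j+3) (j+4) - 1), and that
of the left-hand side is 8 eta - 4 (sum of the three tances) + 3. Adding this
equation to its conjugate expresses the Gram determinant of p j, p (j+1),
p (j+2) (lemma pentagon_gram):

  gram = g j j g (j+1)(j+1) g (j+2)(j+2)
         (1/4 + (delta + delta^* ) (4 tance (j+3) (j+4) - 1) / 8).

In signature ++- the Gram determinant is nonpositive as soon as one of the
vectors is negative (gram_le0), so the last factor is nonnegative when the
three points are negative. The tance of two negative points is at least 1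
(reversed Cauchy-Schwarz inequality), while the tance of a negative and a
positive nonorthogonal point is negative.

If delta <> 1, then delta + delta^* = -1 and the last factor is
3/8 - tance (j+3) (j+4) / 2, negative if all points are negative: hence some
point is positive (pentagon_positive).

If delta = 1, the last factor is tance (j+3) (j+4). A positive point placed at
j+3 would make it negative, so all points are negative
(pentagon_all_negative); then it is at least 1, and any three consecutive
points are linearly independent (pentagon_gram_neq0). Moreover eta is real by
the trace equation, so g j k g k l g l j is real for consecutive j, k, l
(triple_consecutive); comparing matrix coefficients of
r (j+3) o r (j+2) = r (j+4) o r j o r (j+1) at p j gives the same for
j, j+2, j+3 (triple_skew). These two families exhaust the triples of distinct
indices of Z/5. Two negative points are never orthogonal, so p j can be
replaced by w j = (g 0 j) p j, and then
h (w j) (w k) = g 0 j g j k g k 0 is real for all j and k. The form is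
nondegenerate and real on the basis w 0, w 1, w 2, so every vector
with real products with this basis lies in its real span; therefore the w j
span a real form of V, preserved by the reflections in the w j, which are
the r j. *)

Set Implicit Arguments.
Unset Strict Implicit.
Unset Printing Implicit Defensive.

Import Order.TTheory GRing.Theory Num.Theory.
Local Open Scope ring_scope.

(** * Reflections and traces *)

Section HermitianForm.
Variables (R : realType) (V : vectType R[i]).
Variable h : {hermitian_sym V for Num.conj}.
Implicit Types (p q x y : V) (f g : 'End(V)).

Lemma form_conj x y : (h x y)^* = h y x.
Proof. by rewrite [in RHS]hermC expr0 mul1r. Qed.

Lemma formBl x y z : h (x - y) z = h x z - h y z.
Proof. exact: linearBl. Qed.

Lemma formBr x y z : h x (y - z) = h x y - h x z.
Proof. exact: linearBr. Qed.

Lemma formZl (a : R[i]) x y : h (a *: x) y = a * h x y.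
Proof. exact: linearZl_LR. Qed.

Lemma formZr (a : R[i]) x y : h x (a *: y) = a^* * h x y.
Proof. exact: linearZr_LR. Qed.

Lemma formDl x y z : h (x + y) z = h x z + h y z.
Proof. exact: linearDl. Qed.

Lemma formDr x y z : h x (y + z) = h x y + h x z.
Proof. exact: linearDr. Qed.

Lemma form_suml (I : finType) (F : I -> V) y :
  h (\sum_i F i) y = \sum_i h (F i) y.
Proof. exact: linear_sumlz. Qed.

Lemma form_sumr (I : finType) (F : I -> V) x :
  h x (\sum_i F i) = \sum_i h x (F i).
Proof. exact: linear_sumr. Qed.

Lemma form_real x : h x x \is Num.real.
Proof. by apply/CrealP; rewrite form_conj. Qed.

Lemma form_mulC_ge0 x y : 0 <= h x y * h y x.
Proof. by rewrite -(form_conj x y) mul_conjC_ge0. Qed.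

Lemma form_mulC_gt0 x y : h x y != 0 -> 0 < h x y * h y x.
Proof. by rewrite -(form_conj x y) mul_conjC_gt0. Qed.

Lemma form_reflection p x y :
  h (reflection h p x) y = 2 * (h x p / h p p) * h p y - h x y.
Proof. by rewrite reflectionE formBl formZl. Qed.

Lemma reflectionK p : h p p != 0 -> involutive (reflection h p).
Proof.
move=> p0 x; rewrite [LHS]reflectionE form_reflection reflectionE.
rewrite opprB addrCA -scalerBl.
have -> : 2 * ((2 * (h x p / h p p) * h p p - h x p) / h p p)
          - 2 * (h x p / h p p) = 0 by field.
by rewrite scale0r addr0.
Qed.

Lemma reflectionZ (c : R[i]) p :
  c != 0 -> reflection h (c *: p) = reflection h p.
Proof.
move=> c0; apply/lfunP=> x; rewrite !reflectionE !formZl !formZr scalerA.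
congr (_ *: _ - _).
have [->|p0] := eqVneq (h p p) 0; first by rewrite !mulr0 invr0 !mulr0 mul0r.
by field; rewrite p0 c0 conjC_eq0 c0.
Qed.

Definition lftrace f : R[i] :=
  \sum_i coord (vbasis {:V}) i (f (vbasis {:V})`_i).

Lemma lftraceB f g : lftrace (f - g) = lftrace f - lftrace g.
Proof.
rewrite /lftrace -sumrB; apply: eq_bigr => i _.
by rewrite add_lfunE opp_lfunE linearB.
Qed.

Lemma lftraceZ a f : lftrace (a *: f) = a * lftrace f.
Proof.
rewrite /lftrace mulr_sumr; apply: eq_bigr => i _.
by rewrite scale_lfunE linearZ.
Qed.

Lemma lftrace1 : lftrace \1%VF = (\dim {:V})%:R.
Proof.
rewrite /lftrace (eq_bigr (fun=> 1)) ?sumr_const ?card_ord // => i _.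
by rewrite id_lfunE coord_free ?eqxx ?(basis_free (vbasisP _)).
Qed.

(** Expanding p in the basis that defines the trace recovers h p q. *)
Lemma lftrace_rank1 f p q : (forall x, f x = h x q *: p) -> lftrace f = h p q.
Proof.
move=> fE; rewrite [in RHS](coord_vbasis (memvf p)) linear_sumlz.
by apply: eq_bigr => i _; rewrite fE linearZ /= formZl mulrC.
Qed.

(** f o R(p) + f has rank one: it sends x to (2 <x,p> / <p,p>) f(p). The rule
removes the reflections of a product one at a time. *)
Lemma lftrace_comp_reflection f p :
  lftrace (f \o reflection h p)%VF = 2 / h p p * h (f p) p - lftrace f.
Proof.
pose K := (f \o reflection h p + f)%VF.
have KE x : K x = h x (2 / h p p *: p) *: f p.
  rewrite /K add_lfunE comp_lfunE reflectionE linearB linearZ subrK formZr.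
  rewrite rmorphM fmorphV rmorph_nat /= form_conj; congr (_ *: _); ring.
have -> : (f \o reflection h p)%VF = K - f by rewrite addrK.
rewrite lftraceB (lftrace_rank1 KE) formZr rmorphM fmorphV rmorph_nat /=.
by rewrite form_conj.
Qed.


(** * Negative vectors in signature ++- *)

Lemma signature_negative_vector : signature_ppm h ->
  exists e, h e e < 0 /\ forall x, h x e = 0 -> x != 0 -> 0 < h x x.
Proof.
case=> e1 [e2] [e3] [eB [h12 h13 h23] [h1 h2 h3]]; exists e3; split=> // x.
have [a [b [c ->]]] : exists a b c, x = a *: e1 + b *: e2 + c *: e3.
  rewrite (coord_basis (X := [tuple e1; e2; e3]) eB (memvf x)) !big_ord_recl.
  by rewrite big_ord0 addr0 addrA; do 3!eexists.
rewrite !formDl !formZl h13 h23 !mulr0 !add0r => /eqP.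
rewrite mulf_eq0 (lt_eqF h3) orbF => /eqP-> x0.
have h21 : h e2 e1 = 0 by rewrite -form_conj h12 conjC0.
rewrite scale0r addr0 in x0 *.
rewrite !formDr !formZr h12 h21 !(mulr0, mul0r, addr0, add0r) !mulrA.
have [a0|a0] := eqVneq a 0.
  rewrite a0 scale0r add0r in x0; rewrite a0 !mul0r add0r.
  rewrite mulr_gt0 // mul_conjC_gt0.
  by apply: contraNneq x0 => ->; rewrite scale0r.
apply: ltr_wpDr; first by apply: mulr_ge0 (ltW h2); apply: mul_conjC_ge0.
by apply: mulr_gt0 h1; rewrite mul_conjC_gt0.
Qed.

Section Signature.
Hypothesis sigh : signature_ppm h.

(** The combination y of p and x is orthogonal to the distinguished negative vector
e, so h y y >= 0. As p and x are orthogonal, h y y is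
|h x e|^2 h p p + |h p e|^2 h x x, whose first term is negative. *)
Lemma negative_perp_gt0 p x : h p p < 0 -> h x p = 0 -> x != 0 -> 0 < h x x.
Proof.
move=> pN xp x0; have [e [eN eP]] := signature_negative_vector sigh.
have [pe|pe] := eqVneq (h p e) 0.
  have p0 : p != 0 by apply: contraTneq pN => ->; rewrite linear0r ltxx.
  by have := lt_trans pN (eP p pe p0); rewrite ltxx.
have [xe|xe] := eqVneq (h x e) 0; first exact: eP.
pose y := h x e *: p - h p e *: x.
have px : h p x = 0 by rewrite -form_conj xp conjC0.
have yy : h y y = h x e * (h x e)^* * h p p + h p e * (h p e)^* * h x x.
  by rewrite /y !(formBl, formBr, formZl, formZr) xp px; ring.
have y_ge0 : 0 <= h y y.
  have [->|y0] := eqVneq y 0; first by rewrite linear0r.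
  by apply/ltW/eP => //; rewrite /y formBl !formZl mulrC subrr.
have : 0 < h p e * (h p e)^* * h x x.
  apply: lt_le_trans (_ : - (h x e * (h x e)^* * h p p) <= _).
    by rewrite oppr_gt0 pmulr_rlt0 // mul_conjC_gt0.
  by rewrite -subr_ge0 opprK addrC -yy.
by rewrite pmulr_rgt0 // mul_conjC_gt0.
Qed.

Lemma negative_perp_ge0 p x : h p p < 0 -> h x p = 0 -> 0 <= h x x.
Proof.
move=> pN xp; have [->|x0] := eqVneq x 0; first by rewrite linear0r.
exact/ltW/(negative_perp_gt0 pN).
Qed.

Lemma negative_form_neq0 p q : h p p < 0 -> h q q < 0 -> h p q != 0.
Proof.
move=> pN qN; apply/negP => /eqP pq.
by have := negative_perp_ge0 qN pq; rewrite (lt_geF pN).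
Qed.

(** The usual inequality: h is positive definite on the orthogonal of p. *)
Lemma negative_perp_CauchySchwarz p u v : h p p < 0 -> h u p = 0 -> h v p = 0 ->
  h u v * h v u <= h u u * h v v.
Proof.
move=> pN up vp; have [->|v0] := eqVneq v 0.
  by rewrite !(linear0r, linear0l) !mulr0.
have vv := negative_perp_gt0 pN vp v0.
pose w := h v v *: u - h u v *: v.
have : 0 <= h w w.
  by apply: (negative_perp_ge0 pN); rewrite /w formBl !formZl up vp; ring.
have -> : h w w = h v v * (h u u * h v v - h u v * h v u).
  by rewrite /w !(formBl, formBr, formZl, formZr) !form_conj; ring.
by rewrite pmulr_rge0 // subr_ge0.
Qed.

(** The component u of q orthogonal to p has h u u >= 0. *)
Lemma negative_rev_CauchySchwarz p q : h p p < 0 ->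
  h p p * h q q <= h p q * h q p.
Proof.
move=> pN; pose u := h p p *: q - h q p *: p.
have : 0 <= h u u.
  by apply: (negative_perp_ge0 pN); rewrite /u formBl !formZl; ring.
have -> : h u u = h p p * (h p p * h q q - h p q * h q p).
  by rewrite /u !(formBl, formBr, formZl, formZr) !form_conj; ring.
by rewrite nmulr_rge0 // subr_le0.
Qed.

(** The determinant of the Gram matrix of p, q, r. *)
Definition gram p q r : R[i] :=
  h p p * h q q * h r r + h p q * h q r * h r p + h p r * h r q * h q p
  - h p p * (h q r * h r q) - h q q * (h p r * h r p) - h r r * (h p q * h q p).

(** The Cauchy-Schwarz defect of the projections of q and r to the orthogonal of
p is nonnegative. With u the projection multiplied by h p p, it equals
(h p p)^3 times the Gram determinant. *)
Lemma gram_le0 p q r : h p p < 0 -> gram p q r <= 0.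
Proof.
move=> pN; pose u x := h p p *: x - h x p *: p.
have up x : h (u x) p = 0 by rewrite /u formBl !formZl; ring.
have := negative_perp_CauchySchwarz pN (up q) (up r).
rewrite -subr_ge0.
have -> : h (u q) (u q) * h (u r) (u r) - h (u q) (u r) * h (u r) (u q) =
          h p p * h p p * (h p p * gram p q r).
  by rewrite /u /gram !(formBl, formBr, formZl, formZr) !form_conj; ring.
by rewrite pmulr_rge0 ?nmulr_rgt0 // nmulr_rge0.
Qed.

End Signature.

(** Cramer's rule: pairing the relation with p, q and r gives a linear system in
a, b, c whose determinant is gram p q r. *)
Lemma gram_free p q r a b c : gram p q r != 0 ->
  a *: p + b *: q + c *: r = 0 -> [/\ a = 0, b = 0 & c = 0].
Proof.
move=> G0 abc.
have E x : a * h p x + b * h q x + c * h r x = 0.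
  by rewrite -!formZl -!formDl abc linear0l.
have [Ep Eq Er] := And3 (E p) (E q) (E r).
split; apply/eqP; rewrite -(mulIr_eq0 _ (mulIf G0)); apply/eqP.
- transitivity (
    (a * h p p + b * h q p + c * h r p) * (h q q * h r r - h q r * h r q)
    + (a * h p q + b * h q q + c * h r q) * (h r p * h q r - h q p * h r r)
    + (a * h p r + b * h q r + c * h r r) * (h q p * h r q - h r p * h q q)).
    by rewrite /gram; ring.
  by rewrite Ep Eq Er !mul0r !addr0.
- transitivity (
    (a * h p p + b * h q p + c * h r p) * (h r q * h p r - h p q * h r r)
    + (a * h p q + b * h q q + c * h r q) * (h p p * h r r - h p r * h r p)
    + (a * h p r + b * h q r + c * h r r) * (h p q * h r p - h p p * h r q)).
    by rewrite /gram; ring.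
  by rewrite Ep Eq Er !mul0r !addr0.
- transitivity (
    (a * h p p + b * h q p + c * h r p) * (h p q * h q r - h p r * h q q)
    + (a * h p q + b * h q q + c * h r q) * (h p r * h q p - h q r * h p p)
    + (a * h p r + b * h q r + c * h r r) * (h p p * h q q - h p q * h q p)).
    by rewrite /gram; ring.
  by rewrite Ep Eq Er !mul0r !addr0.
Qed.

(** * Traces of products of reflections *)

Section ReflectionTrace.
Hypothesis dimV : \dim {:V} = 3%N.

Lemma lftrace_reflection p : h p p != 0 -> lftrace (reflection h p) = - 1.
Proof.
move=> p0; rewrite -[reflection h p]comp_lfun1l lftrace_comp_reflection.
by rewrite id_lfunE lftrace1 dimV; field.
Qed.

Lemma lftrace_reflection2 p q : h p p != 0 -> h q q != 0 ->
  lftrace (reflection h p \o reflection h q)%VF =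
  4 * (h p q * h q p / (h p p * h q q)) - 1.
Proof.
move=> p0 q0; rewrite lftrace_comp_reflection lftrace_reflection //.
by rewrite form_reflection; field; apply/andP.
Qed.

Lemma lftrace_reflection3 p q r : h p p != 0 -> h q q != 0 -> h r r != 0 ->
  lftrace (reflection h r \o reflection h q \o reflection h p)%VF =
  8 * (h p q * h q r * h r p / (h p p * h q q * h r r))
  - 4 * (h p q * h q p / (h p p * h q q) + h q r * h r q / (h q q * h r r)
         + h p r * h r p / (h p p * h r r)) + 3.
Proof.
move=> p0 q0 r0; rewrite lftrace_comp_reflection lftrace_reflection2 //.
rewrite comp_lfunE !form_reflection; field; exact/and3P.
Qed.

End ReflectionTrace.
End HermitianForm.

(** * The pentagon relation *)

Section Pentagon.
Variables (R : realType) (V : vectType R[i]).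
Variable h : {hermitian_sym V for Num.conj}.
Hypotheses (dimV : \dim {:V} = 3%N) (sigh : signature_ppm h).
Variables (p : 'Z_5 -> V) (delta : R[i]).
Hypothesis pent : pentagon h p delta.
Implicit Types j k : 'Z_5.

Local Notation g j k := (h (p j) (p k)).
Local Notation r j := (reflection h (p j)).

Lemma pentagon_nonisotropic j : g j j != 0.
Proof. by case: pent. Qed.

Lemma pentagon_reflectionK j : involutive (r j).
Proof. exact/reflectionK/pentagon_nonisotropic. Qed.

Lemma Z5_add5 j : j + 5 = j.
Proof. by apply: val_inj; case: j => -[|[|[|[|[|]]]]]. Qed.

(** Conjugating the relation by r k rotates it, as delta is scalar. *)
Lemma pentagon_rotate j x :
  r (j + 4) (r (j + 3) (r (j + 2) (r (j + 1) (r j x)))) = delta *: x.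
Proof.
pose Q j := forall x, 
  r (j + 4) (r (j + 3) (r (j + 2) (r (j + 1) (r j x)))) = delta *: x.
have Z5E : (1 + 4 = 5 :> 'Z_5) * (1 + 3 = 4 :> 'Z_5) * (1 + 2 = 3 :> 'Z_5) *
           (1 + 1 = 2 :> 'Z_5) by do !split; apply: val_inj.
have step k : Q k -> Q (k + 1).
  move=> Qk {}x; rewrite -!addrA !Z5E Z5_add5.
  rewrite -{1}[x](pentagon_reflectionK k) -[RHS](pentagon_reflectionK k).
  by rewrite linearZ /= -Qk.
have Q1 : Q 1.
  move=> y; case: pent => _ _ _ /lfunP/(_ y) + _.
  by rewrite !comp_lfunE scale_lfunE id_lfunE !Z5E.
have Qn n : Q n.+1%:R by elim: n => // n /step; rewrite natr1.
rewrite -[j]Z5_add5 -[j]natr_Zp -natrD addnS; exact: Qn.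
Qed.

Lemma pentagon_relation j x :
  r (j + 2) (r (j + 1) (r j x)) = delta *: r (j + 3) (r (j + 4) x).
Proof.
by rewrite -!linearZ /= -(pentagon_rotate j x) !pentagon_reflectionK.
Qed.

(** For negative points, this is cosh^2 of their distance in the complex
hyperbolic plane, up to the normalization of the metric. *)
Definition tance j k : R[i] := g j k * g k j / (g j j * g k k).

(** The triple product, made independent of the representatives. *)
Definition eta j k l : R[i] := g j k * g k l * g l j / (g j j * g k k * g l l).

Lemma tance_conj j k : (tance j k)^* = tance j k.
Proof.
by rewrite /tance !rmorphM fmorphV rmorphM /= !form_conj [g k j * _]mulrC.
Qed.

Lemma eta_conj j k l :
  (eta j k l)^* = g j l * g l k * g k j / (g j j * g k k * g l l).
Proof.
rewrite /eta !rmorphM fmorphV !rmorphM /= !form_conj.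
by congr (_ / _); ring.
Qed.

(** The traces of the two sides of pentagon_relation. *)
Lemma pentagon_trace j :
  8 * eta j (j + 1) (j + 2)
  - 4 * (tance j (j + 1) + tance (j + 1) (j + 2) + tance j (j + 2)) + 3 =
  delta * (4 * tance (j + 3) (j + 4) - 1).
Proof.
rewrite -lftrace_reflection3 ?pentagon_nonisotropic //.
rewrite -lftrace_reflection2 ?pentagon_nonisotropic // -lftraceZ.
congr lftrace; apply/lfunP=> x.
by rewrite scale_lfunE !comp_lfunE pentagon_relation.
Qed.

(** Only the real part of eta occurs in the Gram determinant, so the trace
equation and its conjugate determine the latter. *)
Lemma pentagon_gram j :
  gram h (p j) (p (j + 1)) (p (j + 2)) =
  g j j * g (j + 1) (j + 1) * g (j + 2) (j + 2)
  * (1 / 4 + (delta + delta^*) * (4 * tance (j + 3) (j + 4) - 1) / 8).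
Proof.
have conjE E s t : s^* = s -> t^* = t ->
    8 * E - 4 * s + 3 = delta * (4 * t - 1) ->
    8 * E^* - 4 * s + 3 = delta^* * (4 * t - 1) :> R[i].
  move=> sC tC /(congr1 Num.conj).
  by rewrite !(rmorphM, rmorphD, rmorphN, rmorph_nat, conjC1) /= sC tC conjC1.
have Tr := pentagon_trace j.
have TrC := conjE _ _ _ _ (tance_conj _ _) Tr.
rewrite !rmorphD /= !tance_conj in TrC; have {}TrC := TrC erefl.
rewrite mulrDl mulrDl -Tr -TrC eta_conj /eta /tance /gram.
field; by rewrite !pentagon_nonisotropic.
Qed.

Lemma pentagon_tance_neq0 j : tance j (j + 1) != 0.
Proof.
case: pent => _ _ /(_ (j + 1)) + _ _; rewrite addrK => -[jj _].
rewrite !mulf_neq0 ?invr_neq0 ?mulf_neq0 ?pentagon_nonisotropic //.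
by rewrite -form_conj conjC_eq0.
Qed.

Lemma pentagon_sign j : (g j j < 0) || (0 < g j j).
Proof.
by rewrite -real_neqr_lt ?real0 ?form_real // pentagon_nonisotropic.
Qed.

Lemma pentagon_negative j k : 0 < g j j -> k != j -> g k k < 0.
Proof.
move=> jP kj; case/orP: (pentagon_sign k) => // kP.
have /card_le1_eqP/(_ k j) : (#|[set l : 'Z_5 | (0 < g l l)%R]%SET| <= 1)%N.
  by case: pent.
by rewrite !inE => /(_ kP jP) jk; rewrite jk eqxx in kj.
Qed.

Lemma tance_ge1 j k : g j j < 0 -> g k k < 0 -> 1 <= tance j k.
Proof.
move=> jN kN; rewrite ler_pdivlMr ?nmulr_rgt0 // mul1r.
exact: negative_rev_CauchySchwarz.
Qed.

Lemma pentagon_gram1 j : delta = 1 ->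
  gram h (p j) (p (j + 1)) (p (j + 2)) =
  g j j * g (j + 1) (j + 1) * g (j + 2) (j + 2) * tance (j + 3) (j + 4).
Proof. by move=> d1; rewrite pentagon_gram d1 conjC1; field. Qed.

(** If p (j+3) is positive, then the tance of p (j+3) and p (j+4) is negative,
and the Gram determinant of the three other points, all negative, would be
positive. *)
Lemma pentagon_all_negative : delta = 1 -> forall j, g j j < 0.
Proof.
move=> d1 k; case/orP: (pentagon_sign k) => // kP.
have [j Ek] : exists j, k = j + 3 by exists (k - 3); rewrite subrK.
have neg a : a != 3 -> g (j + a) (j + a) < 0.
  by move=> a3; apply: (pentagon_negative kP); rewrite Ek (inj_eq (addrI j)).
have j0 : g j j < 0 by rewrite -[j]addr0 neg.
have E4 : j + 3 + 1 = j + 4 by rewrite -addrA; congr (j + _); apply: val_inj.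
have := gram_le0 sigh (p (j + 1)) (p (j + 2)) j0.
rewrite pentagon_gram1 // nmulr_rle0 ?nmulr_llt0 ?nmulr_rgt0 ?neg //.
rewrite le_eqVlt eq_sym -{1}E4 (negPf (pentagon_tance_neq0 _)) /= => t_gt0.
have : tance (j + 3) (j + 4) < 0.
  rewrite /tance pmulr_rlt0 ?invr_lt0 ?pmulr_rlt0 ?neg -?Ek //.
  apply: form_mulC_gt0; case: pent => _ _ /(_ (j + 4)) + _ _.
  by rewrite -E4 addrK Ek => -[].
by move/(lt_trans t_gt0); rewrite ltxx.
Qed.

(** If all points are negative then the tance t in pentagon_gram is at least 1,
and the factor 1/4 - (4 t - 1) / 8 is at most -1/8. *)
Lemma pentagon_positive : delta != 1 -> exists j, 0 < g j j.
Proof.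
move=> d1; have d3 : delta ^+ 3 = 1 by case: pent.
have dC : delta * delta^* = 1.
  rewrite -normCK; apply/eqP; rewrite sqrp_eq1 //.
  by rewrite -(pexpr_eq1 (n := 3)) // -normrX d3 normr1.
have dd : delta + delta^* = -1.
  have dB : delta^* = delta ^+ 2.
    by rewrite -[LHS]mul1r -d3 exprSr -mulrA dC mulr1.
  apply/eqP; rewrite -subr_eq0 opprK dB.
  have : (delta - 1) * (delta + delta ^+ 2 + 1) == 0.
    by apply/eqP; transitivity (delta ^+ 3 - 1); [ring | rewrite d3 subrr].
  by rewrite mulf_eq0 subr_eq0 (negPf d1).
have [/forallP N|] := boolP [forall j, g j j < 0]; last first.
  by case/forallPn=> j /negPf jN; exists j; have := pentagon_sign j; rewrite jN.
have := gram_le0 sigh (p (0 + 1)) (p (0 + 2)) (N 0).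
rewrite pentagon_gram dd nmulr_rle0 ?nmulr_llt0 ?nmulr_rgt0 //.
set t := tance _ _; have t1 : 1 <= t by exact: tance_ge1.
(* The left-hand side is affine in t, equal to -1/8 at t = 1. *)
have -> : 1 / 4 + -1 * (4 * t - 1) / 8 = (- 1 / 8) - (t - 1) / 2 by field.
rewrite subr_ge0 mulN1r => le8.
have : 0 <= - (8^-1 : R[i]).
  by apply: le_trans le8; rewrite divr_ge0 ?subr_ge0 // ler0n.
by rewrite oppr_ge0 lt_geF // invr_gt0 ltr0n.
Qed.

(** * Reality of the triple products when delta is 1 *)

Section TrivialProduct.
Hypothesis delta1 : delta = 1.

Let neg j : g j j < 0.
Proof. exact: pentagon_all_negative. Qed.

Lemma pentagon_gram_neq0 j : gram h (p j) (p (j + 1)) (p (j + 2)) != 0.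
Proof.
rewrite pentagon_gram1 //; apply: mulf_neq0.
  by rewrite !mulf_neq0 ?pentagon_nonisotropic.
by rewrite gt_eqF // (lt_le_trans ltr01) ?tance_ge1.
Qed.

(** When no entry of the Gram matrix vanishes, the p j can be rescaled so that it
becomes real exactly when all triple products are real. *)
Definition triple j k l : R[i] := g j k * g k l * g l j.

Lemma triple_conj j k l : (triple j k l)^* = triple j l k.
Proof. by rewrite /triple !rmorphM /= !form_conj; ring. Qed.

Lemma triple_cycle j k l : triple j k l = triple k l j.
Proof. by rewrite /triple; ring. Qed.

Lemma triple_consecutive j : triple j (j + 1) (j + 2) \is Num.real.
Proof.
have Tr := pentagon_trace j; rewrite delta1 mul1r in Tr.
set t := tance (j + 3) _ in Tr; set s := _ + tance j (j + 2) in Tr.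
have tR : t \is Num.real by apply/CrealP/tance_conj.
have sR : s \is Num.real by rewrite !rpredD //; apply/CrealP/tance_conj.
have etaR : eta j (j + 1) (j + 2) \is Num.real.
  have -> : eta j (j + 1) (j + 2) = (4 * t - 1 - 3 + 4 * s) / 8.
    by rewrite -Tr; field.
  by clearbody t s; rewrite !(rpredM, rpredD, rpredN, rpredV, realn, real1).
have -> : triple j (j + 1) (j + 2) = eta j (j + 1) (j + 2) *
    (g j j * g (j + 1) (j + 1) * g (j + 2) (j + 2)).
  by rewrite /eta /triple divfK // !mulf_neq0 ?pentagon_nonisotropic.
by rewrite rpredM // !rpredM ?form_real.
Qed.

Lemma pentagon_relation2 j x :
  r (j + 3) (r (j + 2) x) = r (j + 4) (r j (r (j + 1) x)).
Proof.
rewrite -[x in LHS](pentagon_reflectionK (j + 1)).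
rewrite -[r (j + 1) x in LHS](pentagon_reflectionK j).
by rewrite pentagon_relation delta1 scale1r pentagon_reflectionK.
Qed.

(** In the matrix coefficient of pentagon_relation2 at p j, the left-hand side
contains triple j (j+2) (j+3), the right-hand side contains
triple j (j+1) (j+4), whose indices are consecutive, and all other terms are
real. *)
Lemma triple_skew j : triple j (j + 2) (j + 3) \is Num.real.
Proof.
have := congr1 (fun x => h x (p j)) (pentagon_relation2 j (p j)).
rewrite !form_reflection; set lhs := LHS; set rhs := RHS => lr.
have n0 := pentagon_nonisotropic.
have -> : triple j (j + 2) (j + 3) = g (j + 2) (j + 2) * g (j + 3) (j + 3) / 4
    * (rhs + g j j * (2 * tance j (j + 3) + 2 * tance j (j + 2) - 1)).
  by rewrite -lr /lhs /triple /tance; field; rewrite !n0.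
have -> : rhs = g j j * (4 * (2 * tance j (j + 1) - 1) * tance j (j + 4)
                         + 2 * tance j (j + 4) - 2 * tance j (j + 1) + 1)
                - 4 * (triple j (j + 1) (j + 4)
                       / (g (j + 1) (j + 1) * g (j + 4) (j + 4))).
  by rewrite /rhs /triple /tance; field; rewrite !n0.
have : triple j (j + 1) (j + 4) \is Num.real.
  have := triple_consecutive (j + 4).
  have [-> ->] : j + 4 + 1 = j /\ j + 4 + 2 = j + 1.
    split; rewrite -addrA; first rewrite -[RHS]addr0.
      by congr (j + _); apply: val_inj.
    by congr (j + _); apply: val_inj.
  by rewrite triple_cycle.
have tR k l : tance k l \is Num.real by apply/CrealP/tance_conj.
have gR := form_real h.
move: (tR j (j + 1)) (tR j (j + 2)) (tR j (j + 3)) (tR j (j + 4)).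
move: (tance _ _) (tance _ _) (tance _ _) (tance _ _) (triple _ _ _).
move=> ? ? ? ? ? ? ? ? ? ?.
by rewrite !(rpredM, rpredD, rpredN, rpredV, realn, real1).
Qed.

(** Up to order, the triples of distinct indices containing 0 are the three
consecutive ones 012, 340, 401 and the three skew ones 023, 240, 301; a
transposition conjugates the product. *)
Lemma triple_real k l : triple 0 k l \is Num.real.
Proof.
have E : (3 + 1 = 4 :> 'Z_5) * (3 + 2 = 0 :> 'Z_5) * (4 + 1 = 0 :> 'Z_5) *
  (4 + 2 = 1 :> 'Z_5) * (2 + 2 = 4 :> 'Z_5) * (2 + 3 = 0 :> 'Z_5) *
  (3 + 3 = 1 :> 'Z_5) by do !split; apply: val_inj.
have T012 := triple_consecutive 0; have T023 := triple_skew 0.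
have T034 := triple_consecutive 3; have T014 := triple_consecutive 4.
have T024 := triple_skew 2; have T013 := triple_skew 3.
rewrite !add0r in T012 T023; rewrite !E in T034 T014 T024 T013.
rewrite -triple_cycle in T034; rewrite triple_cycle in T014.
rewrite -triple_cycle in T024; rewrite triple_cycle in T013.
have sym a b : triple 0 a b \is Num.real -> triple 0 b a \is Num.real.
  by move=> ab; have /CrealP := ab; rewrite triple_conj => ->.
have T0 b : triple 0 0 b \is Num.real.
  by rewrite /triple -mulrA rpredM ?form_real // realE form_mulC_ge0.
have Taa a : triple 0 a a \is Num.real.
  by rewrite /triple mulrAC rpredM ?form_real // realE form_mulC_ge0.
have Z5P (a : 'Z_5) : a \in [:: 0; 1; 2; 3; 4] by case: a => -[|[|[|[|[|]]]]].
have [k0|kn0] := eqVneq k 0; first by rewrite k0.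
have [l0|ln0] := eqVneq l 0; first by rewrite l0 sym.
have [kl|kl] := eqVneq k l; first by rewrite kl.
have := Z5P l; have := Z5P k; rewrite !inE (negPf kn0) (negPf ln0) /=.
by case/or4P=> /eqP k_ /or4P[] /eqP l_; rewrite k_ l_ ?eqxx // in kl *; auto.
Qed.

End TrivialProduct.
End Pentagon.

(** * Real spans *)

Section RealSpan.
Variables (R : realType) (V : vectType R[i]).
Variable h : {hermitian_sym V for Num.conj}.

Section Closure.
Variables (I : finType) (b : I -> V).

Lemma real_span0 : real_span b 0.
Proof. by exists (fun=> 0); rewrite big1 // => i _; rewrite scale0r. Qed.

Lemma real_spanD x y : real_span b x -> real_span b y -> real_span b (x + y).
Proof.
move=> [r ->] [s ->]; exists (fun i => r i + s i).
by rewrite -big_split; apply: eq_bigr => i _; rewrite rmorphD scalerDl.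
Qed.

Lemma real_spanZ (a : R[i]) x :
  a \is Num.real -> real_span b x -> real_span b (a *: x).
Proof.
move=> /complex_realP[c ->] [r ->]; exists (fun i => c * r i).
by rewrite scaler_sumr; apply: eq_bigr => i _; rewrite rmorphM scalerA.
Qed.

Lemma real_spanN x : real_span b x -> real_span b (- x).
Proof. by rewrite -scaleN1r; apply: real_spanZ; rewrite rpredN real1. Qed.

Lemma real_span_gen i : real_span b (b i).
Proof.
exists (fun j => (j == i)%:R); rewrite (bigD1 i) //= eqxx scale1r.
by rewrite big1 ?addr0 // => j /negPf->; rewrite scale0r.
Qed.

Lemma real_form_span : (forall i j, h (b i) (b j) \is Num.real) ->
  forall u v, real_span b u -> real_span b v -> h u v \is Num.real.
Proof.
move=> bR u v [r ->] [s ->]; rewrite form_suml rpred_sum // => i _.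
rewrite form_sumr rpred_sum // => j _; rewrite formZl formZr.
have cR (c : R) : (c%:C)%C \is Num.real by apply/complex_realP; exists c.
by rewrite !rpredM // (CrealP (cR _)).
Qed.

End Closure.

Lemma real_span_sub (I J : finType) (b : I -> V) (w : J -> V) :
  (forall j, real_span b (w j)) -> forall v, real_span w v -> real_span b v.
Proof.
move=> bw v [r ->]; apply: (big_ind (real_span b)).
- exact: real_span0.
- exact: real_spanD.
- by move=> j _; apply: real_spanZ => //; apply/complex_realP; exists (r j).
Qed.

(** Conjugating the coordinates of v gives a vector v' having the same products
with the basis; as h is nondegenerate, v' = v. *)
Lemma real_spanP n (b : n.-tuple V) v : signature_ppm h -> basis_of fullv b ->
  (forall i j, h (tnth b i) (tnth b j) \is Num.real) ->
  (forall i, h v (tnth b i) \is Num.real) ->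
  real_span (tnth b) v.
Proof.
move=> sigh bB bR vR.
have coordE x : x = \sum_i coord b i x *: tnth b i.
  by under eq_bigr do rewrite (tnth_nth 0); exact: coord_basis (memvf x).
pose c i := coord b i v; pose v' := \sum_i (c i)^* *: tnth b i.
have v'b i : h v' (tnth b i) = h v (tnth b i).
  rewrite -(CrealP (vR i)) [v in RHS]coordE !form_suml rmorph_sum.
  by apply: eq_bigr => k _; rewrite !formZl rmorphM /= (CrealP (bR _ _)).
have nd x : h (v' - v) x = 0.
  rewrite (coordE x) form_sumr big1 // => i _.
  by rewrite formZr formBl v'b subrr mulr0.
have v'v : v' = v.
  apply/eqP; rewrite -subr_eq0; apply: contraT => vv.
  have [e [_ eP]] := signature_negative_vector sigh.
  by have := eP _ (nd e) vv; rewrite nd ltxx.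
have cR i : c i \is Num.real.
  apply/CrealP; transitivity (coord b i v'); last by rewrite v'v.
  rewrite /v'; under eq_bigr do rewrite (tnth_nth 0).
  by rewrite coord_sum_free // (basis_free bB).
rewrite (coordE v); apply: (big_ind (real_span _)).
- exact: real_span0.
- exact: real_spanD.
- by move=> i _; apply: real_spanZ (real_span_gen _ _); apply: cR.
Qed.

End RealSpan.

Section Stability.
Variables (R : realType) (V : vectType R[i]).
Variable h : {hermitian_sym V for Num.conj}.
Local Open Scope classical_set_scope.

(** The reflections in the w j preserve the real span W of the w j. This property
is carried through the group together with injectivity and surjectivity on
W, which the case of the inverse requires. *)
Lemma reflection_group_stable (I : finType) (p w : I -> V) :
  (forall j, h (w j) (w j) != 0) ->
  (forall i j, h (w i) (w j) \is Num.real) ->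
  (forall j, reflection h (p j) = reflection h (w j)) ->
  stable_under (reflection_group h p) (proj_image (real_span w)).
Proof.
move=> w0 wR pw.
pose W := real_span w.
have refW j v : W v -> W (reflection h (p j) v).
  move=> Wv; rewrite pw reflectionE; apply: real_spanD (real_spanN Wv).
  apply: real_spanZ (real_span_gen _ _).
  have vw := real_form_span wR Wv (real_span_gen _ j).
  by rewrite rpredM ?rpredM ?rpredV // realn.
have refK j : involutive (reflection h (p j)) by rewrite pw; apply: reflectionK.
have grpW g : reflection_group h p g ->
    [/\ lker g == 0%VS, forall v, W v -> W (g v) &
        forall v, W v -> exists2 u, W u & g u = v].
  elim=> {g} [j||f g _ [f0 fW Wf] _ [g0 gW Wg]|f _ [f0 fW Wf]].
  - split; [exact/lker0P/inv_inj/refK|exact: refW|move=> v Wv].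
    by exists (reflection h (p j) v); [exact: refW|exact: refK].
  - split=> [|v|v Wv]; rewrite ?id_lfunE //.
      by apply/lker0P=> x y; rewrite !id_lfunE.
    by exists v; rewrite ?id_lfunE.
  - split=> [|v Wv|v /Wf[u /Wg[t Wt <-] <-]].
    + apply/lker0P=> x y; rewrite !comp_lfunE.
      by move/(lker0P f0)/(lker0P g0).
    + by rewrite comp_lfunE; exact/fW/gW.
    + by exists t; rewrite ?comp_lfunE.
  - split=> [|v /Wf[u Wu <-]|v Wv].
    + exact/lker0P/(can_inj (lker0_lfunVK f0)).
    + by rewrite lker0_lfunK.
    + by exists (f v); [exact: fW|rewrite lker0_lfunK].
move=> g /grpW[g0 gW Wg]; apply/seteqP; split=> L /=.
  case=> _ [v [Wv /= v0] <-] <-; exists (g v); last by rewrite limg_line.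
  split; [exact: gW|move=> /= gv; apply: v0].
  by apply: (lker0P g0); rewrite gv linear0.
case=> v [/Wg[u Wu <-] /= v0] <-; exists <[u]>%VS; last by rewrite limg_line.
by exists u => //; split=> // u0; apply: v0; rewrite u0 linear0.
Qed.

End Stability.

(** * The real plane of a pentagon with trivial product *)

Section Normalization.
Variables (R : realType) (V : vectType R[i]).
Variable h : {hermitian_sym V for Num.conj}.
Hypotheses (dimV : \dim {:V} = 3%N) (sigh : signature_ppm h).
Variable p : 'Z_5 -> V.
Hypothesis pent : pentagon h p 1.

(** Representatives of the p j having real products with p 0. *)
Definition normalized j := h (p 0) (p j) *: p j.
Local Notation w := normalized.

Let neg j : h (p j) (p j) < 0.
Proof. exact: (pentagon_all_negative dimV sigh pent). Qed.

Let c0 j : h (p 0) (p j) != 0.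
Proof. exact: negative_form_neq0. Qed.

(** The products of the w j are triple products based at 0. *)
Lemma normalized_real j k : h (w j) (w k) \is Num.real.
Proof.
have -> : h (w j) (w k) = triple h p 0 j k.
  by rewrite formZl formZr form_conj /triple; ring.
exact: (triple_real dimV pent erefl).
Qed.

Lemma normalized_line j : <[w j]>%VS = <[p j]>%VS.
Proof.
apply/eqP; rewrite eqEsubv; apply/andP; split; rewrite -memvE.
  by rewrite memvZ ?memv_line.
by rewrite -[X in X \in _](scalerK (c0 j)) memvZ ?memv_line.
Qed.

Lemma normalized_basis : basis_of fullv [tuple w 0; w 1; w 2].
Proof.
rewrite basisEfree subvf dimV leqnn !andbT; apply/freeP => k.
rewrite !big_ord_recl big_ord0 addr0 /= !scalerA addrA => k0.
have G := pentagon_gram_neq0 dimV sigh pent erefl 0; rewrite !add0r in G.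
have [] := gram_free G k0.
move=> /eqP + /eqP + /eqP; rewrite !mulf_eq0 !(negPf (c0 _)) !orbF.
move=> /eqP k1 /eqP k2 /eqP k3 i.
have : i \in [:: ord0; lift ord0 ord0; lift ord0 (lift ord0 ord0)].
  by case: i => -[|[|[|]]].
by rewrite !inE => /or3P[] /eqP->.
Qed.

(** Also w 3 and w 4 lie in the real span of the first three, by real_spanP. *)
Lemma normalized_span : real_span w = real_span (tnth [tuple w 0; w 1; w 2]).
Proof.
have bw i : exists k, tnth [tuple w 0; w 1; w 2] i = w k.
  by case: i => -[|[|[|]]] // lti; [exists 0|exists 1|exists 2].
apply/seteqP; split; apply: real_span_sub => j; last first.
  by have [k ->] := bw j; exact: real_span_gen.
apply: (real_spanP sigh normalized_basis) => [i k|i].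
  by have [? ->] := bw i; have [? ->] := bw k; exact: normalized_real.
by have [? ->] := bw i; exact: normalized_real.
Qed.

Lemma normalized_real_plane : real_plane h (proj_image (real_span w)).
Proof.
exists (real_span w); split=> //.
- exists (tnth [tuple w 0; w 1; w 2]); split; last exact: normalized_span.
  move=> r r0 i; have /freeP fb := basis_free normalized_basis.
  have := fb (fun i => (r i)%:C%C); rewrite -[X in X = 0 -> _]/(\sum_(i < 3) _).
  under eq_bigr do rewrite -tnth_nth.
  by move=> /(_ r0 i) [].
- exists [:: w 0; w 1; w 2]; split; last exact: (span_basis normalized_basis).
  by move=> x; rewrite !inE => /or3P[] /eqP->; exact: real_span_gen.
- exact: real_form_span normalized_real.
Qed.

End Normalization.

Theorem mainTheorem5 (R : realType) (V : vectType R[i])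
    (h : {hermitian_sym V for Num.conj})
    (dimV : \dim {:V} = 3%N) (sigV : signature_ppm h)
    (p : 'Z_5 -> V) (delta : R[i]) (pent : pentagon h p delta) :
  (delta = 1 ->
     (forall j, h (p j) (p j) < 0) /\
     exists P : set {vspace V},
       [/\ real_plane h P,
           real_spans p P,
           forall j, P <[p j]>%VS &
           stable_under (reflection_group h p) P]) /\
  (delta <> 1 ->
     #|[set j : 'Z_5 | 0 < h (p j) (p j)]%SET| = 1%N).
Proof.
split=> [d1|/eqP d1]; last first.
  have [j jP] := pentagon_positive dimV sigV pent d1.
  apply/eqP; rewrite eqn_leq; apply/andP; split; first by case: pent.
  by rewrite card_gt0; apply/set0Pn; exists j; rewrite inE.
have neg := pentagon_all_negative dimV sigV pent d1.
rewrite {}d1 in pent; split=> //.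
have c0 j : h (p 0) (p j) != 0 by exact: negative_form_neq0.
have wp := normalized_line dimV sigV pent.
have wR := normalized_real dimV pent.
exists (proj_image (real_span (normalized h p))); split.
- exact: normalized_real_plane.
- by exists (normalized h p).
- move=> j; rewrite -wp; exists (normalized h p j) => //.
  split; first exact: real_span_gen.
  move=> /= /eqP; rewrite scaler_eq0 (negPf (c0 j)) /= => /eqP pj0.
  by have := c0 j; rewrite pj0 linear0r eqxx.
- apply: reflection_group_stable => // j.
    by rewrite formZl formZr !mulf_neq0 ?conjC_eq0 // lt_eqF.
  by rewrite reflectionZ.
Qed.
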